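(* In the basic Fraenkel model $\mathcal V_{F_0}$, with $A$ its set of atoms, there is no injection from $\mathrm{seq}^{1-1}(A)$ into $\mathrm{Part}_{\mathrm{fin}}(A)$. Consequently (via the Jech–Sochor embedding theorem) it is consistent with ZF that there is an infinite set $X$ with $|\mathrm{seq}^{1-1}(X)|\not\le|\mathrm{Part}_{\mathrm{fin}}(X)|$, so the Dedekind-infiniteness hypothesis in ''$|\mathrm{seq}(X)|<|\mathrm{Part}_{\mathrm{fin}}(X)|$ for Dedekind infinite $X$'' cannot be removed.
   Context: ZFA is Zermelo–Fraenkel set theory with atoms. The basic Fraenkel model $\mathcal V_{F_0}$ is the permutation model obtained from a denumerable set $A$ of atoms, the group $\mathcal G$ of all permutations of $A$, and the normal ideal of finite subsets of $A$: a finite $E\subseteq A$ is a support of $x$ if every $\pi\in\mathcal G$ fixing $E$ pointwise satisfies $\pi x=x$, and $\mathcal V_{F_0}$ consists of the sets $x$ that have a finite support and all of whose elements are in $\mathcal V_{F_0}$ (hereditarily). $\mathrm{seq}^{1-1}(A)$ is the set of injective finite sequences of elements of $A$; $\mathrm{Part}_{\mathrm{fin}}(A)$ is the set of partitions of $A$ all of whose blocks are finite. *)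

(* Defs.v *)
From mathcomp Require Import all_boot.
From mathcomp Require Import boolp classical_sets functions cardinality.
Set Implicit Arguments. Unset Strict Implicit. Unset Printing Implicit Defensive.
Local Open Scope classical_set_scope.

(* The denumerable set of atoms A is modelled by nat.  The group G is the
   group of all permutations (bijections) of A. *)
Definition atom_perm (pi : nat -> nat) : Prop := bijective pi.

Definition fixes_pointwise (pi : nat -> nat) (E : set nat) : Prop :=
  forall a, E a -> pi a = a.

(* seq^{1-1}(A): injective finite sequences of atoms, i.e. [uniq s]. *)

Definition fin_partition (P : set (set nat)) : Prop :=
  [/\ (forall B, P B -> B !=set0 /\ finite_set B),
      (forall a : nat, exists B, P B /\ B a) &
      (forall B C, P B -> P C -> (exists a, B a /\ C a) -> B = C)].

Definition perm_act_part (pi : nat -> nat) (P : set (set nat)) : set (set nat) :=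
  [set pi @` B | B in P].

(* A function f : seq^{1-1}(A) -> Part_fin(A) (given as a total function whose
   values on non-injective sequences are irrelevant) belongs to the basic
   Fraenkel model iff its graph has a finite support E: every permutation
   fixing E pointwise fixes the graph, i.e. f (pi s) = pi (f s). *)
Definition fin_supported_map (f : seq nat -> set (set nat)) : Prop :=
  exists E : set nat, finite_set E /\
    forall pi, atom_perm pi -> fixes_pointwise pi E ->
      forall s, uniq s -> f (map pi s) = perm_act_part pi (f s).

(* Main.v *)
Require Import Defs.
From mathcomp Require Import all_boot.
From mathcomp Require Import boolp classical_sets functions cardinality.
From mathcomp Require Import finmap zify.
Set Implicit Arguments. Unset Strict Implicit. Unset Printing Implicit Defensive.
Local Open Scope classical_set_scope.

(* Let f be an equivariant injection with support below N, P the partition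
   f s of an injective sequence s of atoms >= N.  A permutation fixing the
   atoms < N and s pointwise stabilises P, and a transposition of two atoms of
   s that stabilises P would contradict injectivity.  Hence distinct atoms of s
   lie in distinct blocks, and a block of an atom of s containing no atom < N
   is a singleton (otherwise swap its second element with a fresh atom), so at
   most one atom of s has such a block.  Sending each atom of s to an atom < N
   of its block, or to N, is thus injective on s: s has at most N + 1 atoms,
   and s = [N, 2N + 2) is a counterexample. *)

Lemma finite_nat_bounded (X : set nat) :
  finite_set X -> exists M, forall x, X x -> x < M.
Proof.
move=> /finite_fsetP[Y ->]; exists (\max_(x <- Y) x).+1 => x /= xY.
by rewrite ltnS (leq_bigmax_seq (F := id) _ xY).
Qed.

Definition transp (a b z : nat) : nat :=
  if z == a then b else if z == b then a else z.

Lemma transpK a b : involutive (transp a b).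
Proof.
move=> z; rewrite /transp.
case: (eqVneq z a) => [->|za]; first by rewrite eqxx; case: eqVneq => [->|]; rewrite ?eqxx.
case: (eqVneq z b) => [->|zb]; first by rewrite eqxx.
by rewrite (negbTE za) (negbTE zb).
Qed.

Lemma transp_atom_perm a b : atom_perm (transp a b).
Proof. exact: Bijective (transpK a b) (transpK a b). Qed.

Lemma transp_id a b z : z != a -> z != b -> transp a b z = z.
Proof. by rewrite /transp => /negbTE-> /negbTE->. Qed.

Lemma transp_image_id a b (C : set nat) : (C a <-> C b) -> transp a b @` C = C.
Proof.
move=> Cab.
have C_transp z : C z -> C (transp a b z).
  rewrite /transp; case: (eqVneq z a) => [->|_]; first by move/Cab.
  by case: (eqVneq z b) => [->|_] //; move/Cab.
apply/seteqP; split; first by move=> _ [z Cz <-]; apply: C_transp.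
by move=> z Cz; exists (transp a b z); [apply: C_transp | apply: transpK].
Qed.

Lemma perm_act_part_id pi (P : set (set nat)) : involutive pi ->
  (forall C, P C -> P (pi @` C)) -> perm_act_part pi P = P.
Proof.
move=> piK P_pi; apply/seteqP; split; first by move=> _ [C PC <-]; apply: P_pi.
move=> D PD; exists (pi @` D); first exact: P_pi.
apply/seteqP; split; first by move=> _ [_ [z Dz <-] <-]; rewrite piK.
by move=> z Dz; exists (pi z); [exists z | rewrite piK].
Qed.

Lemma fin_supported_map_bounded f : fin_supported_map f ->
  exists N, forall pi, atom_perm pi -> (forall a, a < N -> pi a = a) ->
    forall s, uniq s -> f (map pi s) = perm_act_part pi (f s).
Proof.
move=> [E [/finite_nat_bounded[N EN] f_equiv]]; exists N => pi pi_perm pi_fix.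
by apply: f_equiv => // a /EN; apply: pi_fix.
Qed.

Section PartitionOfSupportFreeSequence.

Variables (f : seq nat -> set (set nat)) (N : nat).
Hypothesis f_part : forall s, uniq s -> fin_partition (f s).
Hypothesis f_inj : forall s t, uniq s -> uniq t -> f s = f t -> s = t.
Hypothesis f_equiv : forall pi, atom_perm pi -> (forall a, a < N -> pi a = a) ->
  forall s, uniq s -> f (map pi s) = perm_act_part pi (f s).

Variable s : seq nat.
Hypothesis s_uniq : uniq s.
Hypothesis s_large : forall a, a \in s -> N <= a.

Let P := f s.

Let P_finite C : P C -> finite_set C.
Proof. by case: (f_part s_uniq) => blocks _ _ /blocks[]. Qed.

Let P_cover a : exists C, P C /\ C a.
Proof. by case: (f_part s_uniq). Qed.

Let blk (a : nat) : set nat := projT1 (cid (P_cover a)).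

Let blk_part a : P (blk a).
Proof. exact: (projT2 (cid (P_cover a))).1. Qed.

Let blk_mem a : blk a a.
Proof. exact: (projT2 (cid (P_cover a))).2. Qed.

Let blk_unique C a : P C -> C a -> C = blk a.
Proof.
move=> PC Ca; case: (f_part s_uniq) => _ _; apply => //; first exact: blk_part.
by exists a; split; [|apply: blk_mem].
Qed.

Lemma transp_act_outside x y : N <= x -> N <= y -> x \notin s -> y \notin s ->
  perm_act_part (transp x y) P = P.
Proof.
move=> Nx Ny xs ys; rewrite /P -f_equiv //; last 2 first.
- exact: transp_atom_perm.
- by move=> a aN; apply: transp_id; apply/eqP; lia.
congr f; apply: map_id_in => z zs.
by apply: transp_id; apply/eqP => zE; [move: xs | move: ys]; rewrite -zE zs.
Qed.

Lemma transp_inside_not_stable a b : a != b -> a \in s -> b \in s ->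
  ~ (forall C, P C -> P (transp a b @` C)).
Proof.
move=> ab as_ bs P_transp.
have fix_small c : c < N -> transp a b c = c.
  move=> cN; have Na := s_large as_; have Nb := s_large bs.
  by apply: transp_id; apply/eqP; lia.
have ms : map (transp a b) s = map id s.
  have ums : uniq (map (transp a b) s) by rewrite (map_inj_uniq (can_inj (transpK a b))).
  rewrite map_id; apply: f_inj => //; rewrite f_equiv //; last exact: transp_atom_perm.
  exact: perm_act_part_id (transpK a b) _.
have /eqP := (eq_in_map _ _ _).2 ms a as_.
by rewrite /transp eqxx eq_sym (negbTE ab).
Qed.

Lemma blk_inj a b : a \in s -> b \in s -> blk a = blk b -> a = b.
Proof.
move=> as_ bs ab_blk; apply/eqP/negPn/negP => ab.
apply: (transp_inside_not_stable ab as_ bs) => C PC.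
rewrite transp_image_id //; split => Cx.
  by rewrite (blk_unique PC Cx) ab_blk.
by rewrite (blk_unique PC Cx) -ab_blk.
Qed.

Lemma blk_large_singleton a : a \in s -> (forall e, e < N -> ~ blk a e) ->
  blk a = [set a].
Proof.
move=> as_ blk_large; apply/seteqP; split => x; last by move=> ->.
move=> ax; have [//|xa] := eqVneq x a; exfalso.
have Nx : N <= x by rewrite leqNgt; apply/negP => /blk_large.
have xs : x \notin s.
  by apply/negP => xs; move: xa; rewrite (blk_inj xs as_ (esym (blk_unique (blk_part a) ax))) eqxx.
have [M HM] : exists M, forall z, (blk a `|` [set` s]) z -> z < M.
  apply: finite_nat_bounded; rewrite finite_setU; split; last exact: finite_seq.
  exact: P_finite (blk_part a).
pose y := maxn N M.
have ya : ~ blk a y by move=> /(fun h => HM y (or_introl h)); lia.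
have ys : y \notin s by apply/negP => /(fun h => HM y (or_intror h)); lia.
have P_img : P (transp x y @` blk a).
  by rewrite -(transp_act_outside Nx (leq_maxl N M) xs ys); exists (blk a).
have img_a : (transp x y @` blk a) a.
  exists a => //; apply: transp_id; first by rewrite eq_sym.
  by apply/eqP => ay; apply: ya; rewrite -ay.
apply: ya; rewrite -(blk_unique P_img img_a).
by exists x => //; rewrite /transp eqxx.
Qed.

Lemma large_blk_unique a b : a \in s -> b \in s ->
  (forall e, e < N -> ~ blk a e) -> (forall e, e < N -> ~ blk b e) -> a = b.
Proof.
move=> as_ bs a_large b_large; apply/eqP/negPn/negP => ab.
have ea := blk_large_singleton as_ a_large.
have eb := blk_large_singleton bs b_large.
apply: (transp_inside_not_stable ab as_ bs) => C PC.
have [Ca|nCa] := pselect (C a).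
  by rewrite (blk_unique PC Ca) ea image_set1 /transp eqxx -eb.
have [Cb|nCb] := pselect (C b).
  by rewrite (blk_unique PC Cb) eb image_set1 /transp [b == a]eq_sym (negbTE ab) eqxx -ea.
by rewrite transp_image_id.
Qed.

Lemma size_support_free_seq : size s <= N.+1.
Proof.
pose h a := if pselect (exists2 e, e < N & blk a e) is left H
  then projT1 (cid2 H) else N.
have hP a : (h a < N /\ blk a (h a)) \/ (h a = N /\ forall e, e < N -> ~ blk a e).
  rewrite /h; case: pselect => [H|H]; first by case: cid2 => e; left.
  by right; split => // e eN be; apply: H; exists e.
rewrite -(size_map h) -(size_iota 0 N.+1); apply: uniq_leq_size.
  rewrite map_inj_in_uniq // => a b as_ bs hab.
  have [[ha ba]|[ha ba]] := hP a; have [[hb bb]|[hb bb]] := hP b; try lia.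
    apply: blk_inj => //.
    by rewrite (blk_unique (blk_part a) ba) (blk_unique (blk_part b) bb) hab.
  exact: large_blk_unique.
move=> _ /mapP[a _ ->]; rewrite mem_iota.
by have [[? _]|[? _]] := hP a; lia.
Qed.

End PartitionOfSupportFreeSequence.

Theorem theorem3p1 :
  ~ exists f : seq nat -> set (set nat),
      [/\ (forall s, uniq s -> fin_partition (f s)),
          (forall s t, uniq s -> uniq t -> f s = f t -> s = t) &
          fin_supported_map f].
Proof.
move=> [f [f_part f_inj /fin_supported_map_bounded[N f_equiv]]].
have s_large a : a \in iota N N.+2 -> N <= a by rewrite mem_iota => /andP[].
have := size_support_free_seq f_part f_inj f_equiv (iota_uniq N N.+2) s_large.
by rewrite size_iota ltnn.
Qed.
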